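(* Let $d\ge1$, $b>0$, and let $(X_{i,n})_{1\le i\le n,\ n\geq 1}$ be an array of random vectors with values in $\mathbb R^d$ such that for each $n$ the vectors $X_{1,n},\dots,X_{n,n}$ are independent and centered, and such that: 1. there exists $C>0$ such that $\sup_{n\ge1}\rho_3(n)\le C$, where $\rho_3(n):=\frac1n\sum_{i=1}^n\mathbb E[\|X_{i,n}\|^3]$; 2. there exists $c>0$ such that for $n$ large enough $\frac1n\sum_{i=1}^n\mathrm{cov}(X_{i,n})\ge c\,\mathrm{Id}_{\mathbb R^d}$ (in the sense of symmetric matrices); 3. $(X_{i,n})$ belongs to the class $\overline{\mathcal C}(d,b)$. Then there exists a constant $\Gamma>0$ such that, for all $0<\gamma<\frac1b+\frac12$ and for $n$ large enough, $$\mathbb P\left(\frac1{\sqrt n}\left\|\sum_{i=1}^nX_{i,n}\right\|\le\frac1{n^\gamma}\right)\le\frac{\Gamma}{n^{d\gamma}}.$$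
   Context: For a random vector $X$ in $\mathbb R^d$, $\phi_X(t):=\mathbb E[e^{it\cdot X}]$ denotes its characteristic function, and $\|\cdot\|$ is the Euclidean norm. The array $(X_{i,n})_{1\le i\le n}$ belongs to the class $\overline{\mathcal C}(d,b)$ (mean weak Cramer condition with exponent $b>0$) if there exist constants $C>0$ and $R>0$ such that for $n$ large enough and all $t\in\mathbb R^d$ with $\|t\|_2>R$, $$\frac1n\sum_{i=1}^n|\phi_{X_{i,n}}(t)|\le1-\frac{C}{\|t\|_2^b}.$$ *)

(* Defs.v *)
From mathcomp Require Import all_boot all_order all_algebra.
From mathcomp Require Import complex.
From mathcomp Require Import all_classical all_reals all_analysis.

Set Implicit Arguments.
Unset Strict Implicit.
Unset Printing Implicit Defensive.

Import Order.TTheory GRing.Theory Num.Theory.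
Import numFieldNormedType.Exports.

Local Open Scope classical_set_scope.
Local Open Scope ring_scope.

Section euclidean.
Context {R : realType} {d : nat}.

Definition dotv (u v : 'rV[R]_d) : R := \sum_(j < d) u 0 j * v 0 j.

(* The norm `|x| of the library on 'rV[R]_d is the sup norm. *)
Definition norm2 (x : 'rV[R]_d) : R := Num.sqrt (\sum_(j < d) x 0 j ^+ 2).

(* Only meant for symmetric A and B. *)
Definition loewner_le (A B : 'M[R]_d) : Prop :=
  forall v : 'rV[R]_d, 0 <= (v *m (B - A) *m v^T) 0 0.

Definition borel_rV : set (set 'rV[R]_d) :=
  <<s [set U : set 'rV[R]_d | open U] >>.

End euclidean.

Section random_vectors.
Context {disp : measure_display} {T : measurableType disp} {R : realType}
  (P : probability T R) {d : nat}.
Implicit Types X : T -> 'rV[R]_d.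

Definition random_vector X : Prop :=
  forall B : set 'rV[R]_d, borel_rV B -> measurable (X @^-1` B).

Definition mutually_independent (I : finType) (X : I -> T -> 'rV[R]_d) : Prop :=
  forall (J : {set I}) (A : I -> set 'rV[R]_d),
    (forall i, i \in J -> borel_rV (A i)) ->
    P (\bigcap_(i in [set` J]) (X i @^-1` A i)) =
    (\prod_(i in J) P (X i @^-1` A i))%E.

Definition centered X : Prop :=
  forall j : 'I_d, P.-integrable setT (fun w => (X w 0%R j)%:E) /\
                   'E_P[(fun w => X w 0 j)%R]%E = 0%E.

(* The entries are genuine covariances when X has finite second moments. *)
Definition cov_mx X : 'M[R]_d :=
  \matrix_(j < d, k < d)
    fine (covariance P (fun w => X w 0 j) (fun w => X w 0 k)).

(* exp (i x) for real x *)
Definition expi (x : R) : complex R := Complex (cos x) (sin x).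

(* fine is harmless below: charfun only integrates bounded functions. *)
Definition complex_expectation (Z : T -> complex R) : complex R :=
  Complex (fine 'E_P[(fun w => complex.Re (Z w))%R]%E)
          (fine 'E_P[(fun w => complex.Im (Z w))%R]%E).

Definition charfun X (t : 'rV[R]_d) : complex R :=
  complex_expectation (fun w => expi (dotv t (X w))).

(* Row n of the array is indexed by i = 0, ..., n - 1. *)
Implicit Types Xa : forall n : nat, 'I_n -> T -> 'rV[R]_d.

Definition rho3 Xa (n : nat) : \bar R :=
  ((n%:R^-1)%:E * \sum_(i < n) 'E_P[(fun w => norm2 (Xa n i w) ^+ 3)%R])%E.

Definition mean_weak_cramer Xa (b : R) : Prop :=
  exists C r : R, [/\ 0 < C, 0 < r &
    \forall n \near \oo, forall t : 'rV[R]_d, r < norm2 t ->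
      n%:R^-1 * \sum_(i < n) ComplexField.Normc.normc (charfun (Xa n i) t)
        <= 1 - C / norm2 t `^ b].

End random_vectors.

(* Main.v *)
Require Import Defs.
From mathcomp Require Import all_boot all_order all_algebra.
From mathcomp Require Import complex.
From mathcomp Require Import all_classical all_reals all_analysis.
From mathcomp Require Import measurable_realfun zify ring lra.

(** The proof is Fourier-analytic, with every integral over frequencies replaced
    by a finite sum over integer points.

    Let Y be the normalized sum and N an integer of order n^gamma. On the event
    that Y is within n^-gamma of the origin, the phases k . Y with k in the box
    {0, ..., N-1}^d are all at most 1 in absolute value, so that the sum of
    their cosines is at least N^d cos 1. Squaring, taking expectations and using
      sum_{k,l} cos ((k - l) . Y) = (sum_k cos (k . Y))^2 + (sum_k sin (k . Y))^2
    bounds N^(2d) (cos 1)^2 times the probability by the sum over k, l of the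
    moduli |phi_Y (k - l)| ([concentration_le_lattice_sum]). If the inner sums
    over k are bounded by a constant, uniformly in l and N, the probability is
    O(N^-d), which is the claim. No integrability of phi_Y is involved, since
    only finitely many frequencies occur.

    By independence |phi_Y (t)| is the product of the |phi_i (s)|, s = t / sqrt n
    ([charfun_independent_sum]), hence at most exp (- n (1 - m(s))), where m(s)
    is the average modulus of the n characteristic functions at s. For large s,
    the Cramer condition says 1 - m(s) >= C / |s|^b; as |s| = O(n^(gamma - 1/2)),
    this gives exp (- C n^a) with a = 1 + b/2 - b gamma, and a > 0 is exactly the
    restriction on gamma. Summed over the N^d frequencies this stays below 1.
    For the remaining s the same condition is propagated towards the origin by
    the doubling inequality 1 - |phi (2 s)| <= 4 (1 - |phi (s)|)
    ([charfun_doubling]): k doublings lose a factor 4^k and multiply |s|^2 by the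
    same factor, so that 1 - m(s) is at least a constant times |s|^2
    ([mean_modulus_quadratic]). This is a Gaussian bound on phi_Y, and a Gaussian
    has bounded sums over translates of the lattice
    ([gaussian_lattice_sum_le]). *)

Set Implicit Arguments.
Unset Strict Implicit.
Unset Printing Implicit Defensive.

Import Order.TTheory GRing.Theory Num.Theory.
Import numFieldNormedType.Exports.

Local Open Scope classical_set_scope.
Local Open Scope ring_scope.

Local Notation normc := ComplexField.Normc.normc.
Local Notation Re := complex.Re.
Local Notation Im := complex.Im.

(** * Expectation of bounded random variables *)

Section bounded_expectation.
Context {disp : measure_display} {T : measurableType disp} {R : realType}
  (P : probability T R).
Implicit Types f g : T -> R.
Implicit Types Z W : T -> R[i].

(** Only bounded functions of the random vectors are integrated, so this class
    replaces integrability side conditions; it is stable under sums and products. *)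
Definition bounded_measurable f :=
  measurable_fun setT f /\ exists M, forall w, `|f w| <= M.

Definition mean f : R := fine 'E_P[f]%E.

Lemma meanE f : mean f = \int[P]_w f w.
Proof. by rewrite /mean unlock. Qed.

Lemma bounded_measurable_integrable f :
  bounded_measurable f -> P.-integrable setT (EFin \o f).
Proof.
move=> [mf [M fM]]; apply: measurable_bounded_integrable => //.
  by apply: (le_lt_trans (probability_le1 P measurableT)); rewrite ltry.
by exists M; split; [exact: num_real|] => y /ltW My w _; exact: le_trans My.
Qed.

Lemma bounded_measurable_cst (c : R) : bounded_measurable (fun=> c).
Proof. by split; [exact: measurable_cst | exists `|c|]. Qed.

Lemma bounded_measurableD f g : bounded_measurable f -> bounded_measurable g ->
  bounded_measurable (fun w => f w + g w).
Proof.
move=> [mf [M fM]] [mg [N gN]]; split; first exact: measurable_funD.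
by exists (M + N) => w; rewrite (le_trans (ler_normD _ _))// lerD.
Qed.

Lemma bounded_measurableM f g : bounded_measurable f -> bounded_measurable g ->
  bounded_measurable (fun w => f w * g w).
Proof.
move=> [mf [M fM]] [mg [N gN]]; split; first exact: measurable_funM.
by exists (M * N) => w; rewrite normrM ler_pM.
Qed.

Lemma bounded_measurable_sum (I : Type) (s : seq I) (F : I -> T -> R) :
  (forall i, bounded_measurable (F i)) ->
  bounded_measurable (fun w => \sum_(i <- s) F i w).
Proof.
move=> bF; elim: s => [|i s IH].
  by under eq_fun do rewrite big_nil; exact: bounded_measurable_cst.
by under eq_fun do rewrite big_cons; exact: bounded_measurableD.
Qed.

Lemma bounded_measurable_indic (A : set T) : measurable A ->
  bounded_measurable (\1_A : T -> R).
Proof.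
move=> mA; split; first exact: measurable_indic.
by exists 1 => w; rewrite indicE; case: (_ \in _); rewrite ?normr1 ?normr0.
Qed.

Lemma mean_cst (c : R) : mean (fun=> c) = c.
Proof.
rewrite meanE Rintegral_cst//.
by rewrite (_ : _ setT = 1%E) ?mulr1//; exact: probability_setT.
Qed.

Lemma meanD f g : bounded_measurable f -> bounded_measurable g ->
  mean (fun w => f w + g w) = mean f + mean g.
Proof.
move=> bf bg.
by rewrite !meanE RintegralD//; exact: bounded_measurable_integrable.
Qed.

Lemma meanZ (c : R) f : bounded_measurable f ->
  mean (fun w => c * f w) = c * mean f.
Proof.
by move=> bf; rewrite !meanE RintegralZl//; exact: bounded_measurable_integrable.
Qed.

Lemma mean_sum (I : Type) (s : seq I) (F : I -> T -> R) :
  (forall i, bounded_measurable (F i)) ->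
  mean (fun w => \sum_(i <- s) F i w) = \sum_(i <- s) mean (F i).
Proof.
move=> bF; elim: s => [|i s IH].
  by under eq_fun do rewrite big_nil; rewrite big_nil mean_cst.
under eq_fun do rewrite big_cons.
by rewrite big_cons -IH meanD//; exact: bounded_measurable_sum.
Qed.

Lemma le_mean f g : bounded_measurable f -> bounded_measurable g ->
  (forall w, f w <= g w) -> mean f <= mean g.
Proof.
move=> bf bg fg; rewrite !meanE; apply: le_Rintegral => //;
  exact: bounded_measurable_integrable.
Qed.

Lemma mean_indic (A : set T) : measurable A ->
  mean (\1_A : T -> R) = fine (P A).
Proof. by move=> mA; rewrite /mean expectation_indic. Qed.

Lemma le_norm_mean f (M : R) : bounded_measurable f ->
  (forall w, `|f w| <= M) -> `|mean f| <= M.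
Proof.
move=> bf fM; rewrite ler_norml -(mean_cst (- M)) -{2}(mean_cst M).
by apply/andP; split; apply: le_mean => //; try exact: bounded_measurable_cst;
  move=> w; have := fM w; rewrite ler_norml => /andP[].
Qed.

End bounded_expectation.

(** * Complex numbers and their modulus *)

Section complex_preliminaries.
Context {R : realType}.
Implicit Types z w : R[i].

Lemma Re_complexD z w : Re (z + w) = Re z + Re w.
Proof. by case: z w => [a b] [c e]. Qed.

Lemma Im_complexD z w : Im (z + w) = Im z + Im w.
Proof. by case: z w => [a b] [c e]. Qed.

Lemma Re_complex_sum (I : Type) (s : seq I) (F : I -> R[i]) :
  Re (\sum_(i <- s) F i) = \sum_(i <- s) Re (F i).
Proof. by elim: s => [|i s IH]; rewrite ?big_nil// !big_cons Re_complexD IH. Qed.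

Lemma Im_complex_sum (I : Type) (s : seq I) (F : I -> R[i]) :
  Im (\sum_(i <- s) F i) = \sum_(i <- s) Im (F i).
Proof. by elim: s => [|i s IH]; rewrite ?big_nil// !big_cons Im_complexD IH. Qed.

Lemma Re_complexM z w : Re (z * w) = Re z * Re w - Im z * Im w.
Proof. by case: z w => [a b] [c e]. Qed.

Lemma Im_complexM z w : Im (z * w) = Re z * Im w + Im z * Re w.
Proof. by case: z w => [a b] [c e]. Qed.

Lemma Re_complexB z w : Re (z - w) = Re z - Re w.
Proof. by case: z w => [a b] [c e]. Qed.

Lemma Im_complexB z w : Im (z - w) = Im z - Im w.
Proof. by case: z w => [a b] [c e]. Qed.

Lemma normcE z : normc z = Num.sqrt (Re z ^+ 2 + Im z ^+ 2).
Proof. by case: z. Qed.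

Lemma normc_ge0 z : 0 <= normc z.
Proof. by rewrite normcE sqrtr_ge0. Qed.

Lemma sqr_normcE z : normc z ^+ 2 = Re z ^+ 2 + Im z ^+ 2.
Proof. by rewrite normcE sqr_sqrtr// addr_ge0// sqr_ge0. Qed.

Lemma norm_Re_le z : `|Re z| <= normc z.
Proof. by rewrite normcE -sqrtr_sqr ler_wsqrtr// lerDl sqr_ge0. Qed.

Lemma norm_Im_le z : `|Im z| <= normc z.
Proof. by rewrite normcE -sqrtr_sqr ler_wsqrtr// lerDr sqr_ge0. Qed.

Lemma normc_le2 z (M : R) : `|Re z| <= M -> `|Im z| <= M -> normc z <= 2 * M.
Proof.
move=> reM imM; have M0 : 0 <= M := le_trans (normr_ge0 _) reM.
rewrite -(@ler_pXn2r _ 2) ?nnegrE ?normc_ge0 ?mulr_ge0//.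
rewrite sqr_normcE -(real_normK (num_real (Re z))) -(real_normK (num_real (Im z))).
have := lerXn2r 2 (normr_ge0 (Re z) : _ \in Num.nneg) (M0 : _ \in Num.nneg) reM.
have := lerXn2r 2 (normr_ge0 (Im z) : _ \in Num.nneg) (M0 : _ \in Num.nneg) imM.
rewrite exprMn; have := sqr_ge0 M; nra.
Qed.

Lemma normc_prod (I : Type) (s : seq I) (F : I -> R[i]) :
  normc (\prod_(i <- s) F i) = \prod_(i <- s) normc (F i).
Proof.
elim: s => [|i s IH]; first by rewrite !big_nil ComplexField.Normc.normc1.
by rewrite !big_cons ComplexField.Normc.normcM IH.
Qed.

(** Telescoping: the factors are exchanged one at a time, each exchange costing D
    while the other factors stay below M. *)
Lemma normc_prodB_le (I : Type) (s : seq I) (a b : I -> R[i]) (M D : R) :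
  1 <= M -> (forall i, normc (a i) <= M) -> (forall i, normc (b i) <= M) ->
  (forall i, normc (a i - b i) <= D) ->
  normc (\prod_(i <- s) a i - \prod_(i <- s) b i)
    <= (size s)%:R * M ^+ size s * D.
Proof.
move=> M1 aM bM abD; have M0 : 0 <= M by lra.
have bn r : normc (\prod_(i <- r) b i) <= M ^+ size r.
  elim: r => [|i r IH]; first by rewrite big_nil ComplexField.Normc.normc1.
  by rewrite big_cons ComplexField.Normc.normcM exprS ler_pM ?normc_ge0.
elim: s => [|i s IH].
  by rewrite !big_nil subrr ComplexField.Normc.normc0 mul0r mul0r.
rewrite !big_cons.
have -> : a i * \prod_(j <- s) a j - b i * \prod_(j <- s) b j =
  a i * (\prod_(j <- s) a j - \prod_(j <- s) b j)
  + (a i - b i) * \prod_(j <- s) b j by ring.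
apply: le_trans (le_normcD _ _) _; rewrite !ComplexField.Normc.normcM /=.
have h1 := ler_pM (normc_ge0 _) (normc_ge0 _) (aM i) IH.
have h2 := ler_pM (normc_ge0 _) (normc_ge0 _) (abD i) (bn s).
apply: le_trans (lerD h1 h2) _.
have D0 : 0 <= D := le_trans (normc_ge0 _) (abD i).
have Mn : M ^+ size s <= M ^+ (size s).+1 by exact: ler_weXn2l.
rewrite -natr1 exprS in Mn *.
have := ler_wpM2r D0 Mn; lra.
Qed.

End complex_preliminaries.

(** * Complex expectation and independence of finitely valued functions *)

Section complex_expectation_theory.
Context {disp : measure_display} {T : measurableType disp} {R : realType}
  (P : probability T R).
Implicit Types Z W : T -> R[i].

Local Notation cE := (complex_expectation P).

Definition cbounded_measurable Z :=
  bounded_measurable (fun w => Re (Z w)) /\ bounded_measurable (fun w => Im (Z w)).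

Lemma Re_cE Z : Re (cE Z) = mean P (fun w => Re (Z w)). Proof. by []. Qed.
Lemma Im_cE Z : Im (cE Z) = mean P (fun w => Im (Z w)). Proof. by []. Qed.

Lemma cbounded_measurableM Z W : cbounded_measurable Z ->
  cbounded_measurable W -> cbounded_measurable (fun w => Z w * W w).
Proof.
have bN f : bounded_measurable f -> bounded_measurable (fun w : T => - f w : R).
  move=> bf; under eq_fun do rewrite -mulN1r.
  by apply: bounded_measurableM => //; exact: bounded_measurable_cst.
move=> [rZ iZ] [rW iW]; split.
  under eq_fun do rewrite Re_complexM.
  apply: bounded_measurableD; first exact: bounded_measurableM.
  by apply: bN; exact: bounded_measurableM.
under eq_fun do rewrite Im_complexM.
by apply: bounded_measurableD; exact: bounded_measurableM.
Qed.

Lemma cbounded_measurable_prod (I : Type) (s : seq I) (F : I -> T -> R[i]) :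
  (forall i, cbounded_measurable (F i)) ->
  cbounded_measurable (fun w => \prod_(i <- s) F i w).
Proof.
move=> bF; elim: s => [|i s IH].
  under eq_fun do rewrite big_nil.
  by split; exact: bounded_measurable_cst.
by under eq_fun do rewrite big_cons; exact: cbounded_measurableM.
Qed.

Lemma complex_combination_bounded_measurable (I : Type) (s : seq I)
    (c : I -> R[i]) (f : I -> T -> R) :
  (forall i, bounded_measurable (f i)) ->
  cbounded_measurable (fun w => \sum_(i <- s) c i * (f i w)%:C%C).
Proof.
move=> bf; split.
  under eq_fun do rewrite Re_complex_sum; apply: bounded_measurable_sum => i.
  under eq_fun do rewrite Re_complexM mulr0 subr0.
  apply: bounded_measurableM; [exact: bounded_measurable_cst | exact: bf].
under eq_fun do rewrite Im_complex_sum; apply: bounded_measurable_sum => i.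
under eq_fun do rewrite Im_complexM mulr0 add0r.
apply: bounded_measurableM; [exact: bounded_measurable_cst | exact: bf].
Qed.

Lemma complex_expectation_combination (I : Type) (s : seq I)
    (c : I -> R[i]) (f : I -> T -> R) :
  (forall i, bounded_measurable (f i)) ->
  cE (fun w => \sum_(i <- s) c i * (f i w)%:C%C) =
  \sum_(i <- s) c i * (mean P (f i))%:C%C.
Proof.
move=> bf; apply/eqP; rewrite eq_complex Re_cE Im_cE Re_complex_sum Im_complex_sum.
apply/andP; split; apply/eqP.
  under [in LHS]eq_fun do rewrite Re_complex_sum.
  rewrite mean_sum; last first.
    move=> i; under eq_fun do rewrite Re_complexM mulr0 subr0.
    apply: bounded_measurableM; [exact: bounded_measurable_cst | exact: bf].
  apply: eq_bigr => i _.
  under [in LHS]eq_fun do rewrite Re_complexM mulr0 subr0.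
  by rewrite Re_complexM mulr0 subr0 -meanZ.
under [in LHS]eq_fun do rewrite Im_complex_sum.
rewrite mean_sum; last first.
  move=> i; under eq_fun do rewrite Im_complexM mulr0 add0r.
  apply: bounded_measurableM; [exact: bounded_measurable_cst | exact: bf].
apply: eq_bigr => i _.
under [in LHS]eq_fun do rewrite Im_complexM mulr0 add0r.
by rewrite Im_complexM mulr0 add0r -meanZ.
Qed.

(** The constant 2 is the price of arguing separately on real and imaginary
    parts; the sharp constant 1 is irrelevant where this is applied. *)
Lemma complex_expectation_close Z W (D : R) :
  cbounded_measurable Z -> cbounded_measurable W ->
  (forall w, normc (Z w - W w) <= D) -> normc (cE Z - cE W) <= 2 * D.
Proof.
have meanB (f g : T -> R) : bounded_measurable f -> bounded_measurable g ->
    (forall w, `|f w - g w| <= D) -> `|mean P f - mean P g| <= D.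
  move=> bf bg fgD.
  have bNg : bounded_measurable (fun w => - 1 * g w).
    by apply: bounded_measurableM => //; exact: bounded_measurable_cst.
  have -> : mean P f - mean P g = mean P (fun w => f w + (- 1) * g w).
    by rewrite meanD// meanZ// mulN1r.
  apply: le_norm_mean; first exact: bounded_measurableD.
  by move=> w; rewrite mulN1r.
move=> [rZ iZ] [rW iW] ZWD; apply: normc_le2.
  rewrite Re_complexB !Re_cE; apply: meanB => // w; rewrite -Re_complexB.
  exact: le_trans (norm_Re_le _) (ZWD w).
rewrite Im_complexB !Im_cE; apply: meanB => // w; rewrite -Im_complexB.
exact: le_trans (norm_Im_le _) (ZWD w).
Qed.

End complex_expectation_theory.

Section independence.
Context {disp : measure_display} {T : measurableType disp} {R : realType}
  (P : probability T R) {d : nat}.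
Local Notation cE := (complex_expectation P).
Local Notation Borel := (g_sigma_algebraType [set U : set 'rV[R]_d | open U]).

Lemma prod_indic (I : finType) (S : I -> set T) (w : T) :
  \prod_(i : I) (\1_(S i) w : R) = \1_(\bigcap_(i in [set` [set: I]%SET]) S i) w.
Proof.
rewrite [RHS]indicE; have [/set_mem wS|] := boolP (w \in _).
  by rewrite big1// => i _; rewrite indicE mem_set//; apply: wS => /=; rewrite inE.
move=> /negP wS; have [i /negPf wSi] : exists i, w \notin S i.
  apply: contra_notP wS => /forallNP wS; apply/mem_set => i _.
  by apply/set_mem/negPn/negP/wS.
by rewrite (bigD1 i)//= indicE wSi mul0r.
Qed.

Lemma fine_prod (I : Type) (s : seq I) (Q : pred I) (F : I -> \bar R) :
  (forall i, F i \is a fin_num) ->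
  fine (\prod_(i <- s | Q i) F i)%E = \prod_(i <- s | Q i) fine (F i).
Proof.
move=> Ffin; rewrite -[RHS]/(fine (_ %:E)) -prodEFin; congr fine.
by apply: eq_bigr => i _; rewrite fineK.
Qed.

(** Functions with finitely many values: expanding the product of sums gives one
    term per assignment f of a value to each index, and the expectation of that
    term is the probability of an intersection, where independence applies. *)
Lemma independent_simple_prod (I V : finType) (X : I -> T -> 'rV[R]_d)
    (c : V -> R[i]) (A : I -> V -> set 'rV[R]_d) :
  (forall i, random_vector (X i)) -> mutually_independent P X ->
  (forall i v, borel_rV (A i v)) ->
  cbounded_measurable
    (fun w => \prod_(i : I) \sum_(v : V) c v * (\1_(A i v) (X i w))%:C%C) /\
  cE (fun w => \prod_(i : I) \sum_(v : V) c v * (\1_(A i v) (X i w))%:C%C) =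
  \prod_(i : I) cE (fun w => \sum_(v : V) c v * (\1_(A i v) (X i w))%:C%C).
Proof.
move=> rX indX bA.
have mXA i v : measurable (X i @^-1` A i v) by exact: rX.
pose S (f : {ffun I -> V}) :=
  \bigcap_(i in [set` [set: I]%SET]) (X i @^-1` A i (f i)).
have mS f : measurable (S f) by exact: fin_bigcap_measurable.
have -> : (fun w => \prod_(i : I) \sum_(v : V) c v * (\1_(A i v) (X i w))%:C%C) =
    (fun w => \sum_(f : {ffun I -> V})
                (\prod_(i : I) c (f i)) * (\1_(S f) w)%:C%C).
  apply/funext => w; rewrite bigA_distr_bigA; apply: eq_bigr => f _.
  by rewrite big_split/= -prod_indic rmorph_prod.
have bS f : bounded_measurable (\1_(S f) : T -> R).
  exact: bounded_measurable_indic.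
split; first exact: complex_combination_bounded_measurable.
rewrite complex_expectation_combination//.
under [RHS]eq_bigr => i _.
  rewrite (_ : (fun w => _) =
    (fun w => \sum_(v : V) c v * (\1_(X i @^-1` A i v) w)%:C%C)); last first.
    by apply/funext => w; apply: eq_bigr => v _; rewrite !indicE.
  rewrite complex_expectation_combination; last first.
    by move=> v; exact: bounded_measurable_indic.
  over.
rewrite bigA_distr_bigA; apply: eq_bigr => f _.
rewrite big_split/= -rmorph_prod; congr (_ * (_)%:C%C).
rewrite mean_indic// indX; last by move=> i _; exact: bA.
rewrite fine_prod; last by move=> i; exact: fin_num_measure.
by rewrite big_mkcond/=; apply: eq_bigr => i _; rewrite inE mean_indic.
Qed.

End independence.

(** * Expectation of products of independent factors *)

Section borel.
Context {R : realType} {d : nat}.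
Local Notation Borel := (g_sigma_algebraType [set U : set 'rV[R]_d | open U]).

(** Seeing R^d as the measurable type generated by its open sets lets the library
    lemmas on measurable functions produce Borel sets. *)
Lemma borel_rVE (A : set 'rV[R]_d) : borel_rV A = measurable (A : set Borel).
Proof. by []. Qed.

Lemma measurable_coord (j : 'I_d) : measurable_fun setT (fun x : Borel => x 0 j).
Proof.
apply: (measurability _ (RGenOInfty.measurableE R)) => _ [_ [a ->] <-].
rewrite setTI; apply: sub_sigma_algebra => /=.
apply: (@open_comp 'rV[R]_d R (fun x => x 0 j)) => [x _|].
  exact: coord_continuous.
exact: interval_open.
Qed.

Lemma measurable_dotv (t : 'rV[R]_d) : measurable_fun setT (dotv t : Borel -> R).
Proof.
apply: measurable_sum => j; apply: measurable_funM.
  exact: measurable_cst.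
exact: measurable_coord.
Qed.

Lemma random_vector_comp {disp : measure_display} {T : measurableType disp}
    (X : T -> 'rV[R]_d) (f : Borel -> R) :
  random_vector X -> measurable_fun setT f ->
  measurable_fun setT (fun w => f (X w)).
Proof.
move=> rX mf _ B mB; rewrite setTI.
have := mf measurableT B mB; rewrite setTI => /rX.
by rewrite -comp_preimage.
Qed.

End borel.

Section grid.
Context {R : realType}.
Implicit Types K : nat.

(** The interval [-1, 1] is cut into cells of length 1/K, the cell of index v being
    represented by its left end point. *)
Definition grid_cell K (v : nat) (x : R) := v%:R <= K%:R * (x + 1) < v.+1%:R.

Definition grid_point K (v : nat) : R := v%:R / K%:R - 1.

Lemma grid_cell_exists K (x : R) : `|x| <= 1 ->
  exists2 v : 'I_(K.*2).+1, grid_cell K v x &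
    forall u : 'I_(K.*2).+1, grid_cell K u x -> u = v.
Proof.
rewrite ler_norml => /andP[x1 x2].
have x0 : 0 <= K%:R * (x + 1) by rewrite mulr_ge0//; lra.
have vK : (Num.truncn (K%:R * (x + 1)) < (K.*2).+1)%N.
  rewrite truncn_lt_nat// -natr1 -mul2n natrM.
  by have : (0 : R) <= K%:R by []; nra.
exists (Ordinal vK); first exact: truncn_itv.
by move=> u /truncn_def uE; apply/val_inj; rewrite /= uE.
Qed.

Lemma grid_cell_close K v (x : R) : (0 < K)%N -> grid_cell K v x ->
  `|x - grid_point K v| <= K%:R^-1.
Proof.
move=> K0 /andP[]; rewrite -natr1 => v1 v2.
have K0' : (0 : R) < K%:R by rewrite ltr0n.
have -> : x - grid_point K v = (K%:R * (x + 1) - v%:R) * K%:R^-1.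
  by rewrite /grid_point; field; rewrite gt_eqF.
rewrite normrM [`|K%:R^-1|]gtr0_norm ?invr_gt0// ler_piMl ?invr_ge0//.
by rewrite ler_norml; apply/andP; split; lra.
Qed.

Lemma grid_point_le1 K (v : 'I_(K.*2).+1) : (0 < K)%N -> `|grid_point K v| <= 1.
Proof.
move=> K0; have K0' : (0 : R) < K%:R by rewrite ltr0n.
rewrite /grid_point ler_norml; apply/andP; split.
  by rewrite lerBrDr addNr divr_ge0.
rewrite lerBlDr ler_pdivrMr//.
have : (v%:R : R) <= (2 * K)%:R by rewrite ler_nat mul2n -ltnS.
by rewrite natrM; lra.
Qed.

Lemma measurable_grid_cell {disp} {T : measurableType disp} K v (f : T -> R) :
  measurable_fun setT f -> measurable [set x | grid_cell K v (f x)].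
Proof.
move=> mf; have mg : measurable_fun setT (fun x => K%:R * (f x + 1)).
  apply: measurable_funM; first exact: measurable_cst.
  by apply: measurable_funD => //; exact: measurable_cst.
have -> : [set x | grid_cell K v (f x)] =
    setT `&` (fun x => K%:R * (f x + 1)) @^-1` `[v%:R, v.+1%:R[%classic.
  by apply/seteqP; split=> x /=; rewrite in_itv/=; [split|case].
exact: mg.
Qed.

End grid.

Section independence_expectation.
Context {disp : measure_display} {T : measurableType disp} {R : realType}
  (P : probability T R) {d : nat}.
Local Notation cE := (complex_expectation P).
Local Notation Borel := (g_sigma_algebraType [set U : set 'rV[R]_d | open U]).

Lemma sum_pointmass (V : finType) (c : V -> R[i]) (p : V -> R) (v0 : V) :
  p v0 = 1 -> (forall v, v != v0 -> p v = 0) ->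
  \sum_v c v * (p v)%:C%C = c v0.
Proof.
move=> p1 p0; rewrite (bigD1 v0)//= p1 mulr1 big1 ?addr0// => v /p0 ->.
by rewrite mulr0.
Qed.

(** Rounding real and imaginary parts to a grid of mesh 1/K reduces the claim to
    finitely many values, up to an error O(1/K) that is uniform on T; then K is
    arbitrary. *)
Lemma independent_expectation_prod (I : finType) (X : I -> T -> 'rV[R]_d)
    (h : I -> 'rV[R]_d -> R[i]) :
  (forall i, random_vector (X i)) -> mutually_independent P X ->
  (forall i, measurable_fun setT (fun x : Borel => Re (h i x))) ->
  (forall i, measurable_fun setT (fun x : Borel => Im (h i x))) ->
  (forall i x, normc (h i x) <= 1) ->
  cE (fun w => \prod_(i : I) h i (X i w)) =
  \prod_(i : I) cE (fun w => h i (X i w)).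
Proof.
move=> rX indX mRe mIm h1.
have Re1 i x : `|Re (h i x)| <= 1 := le_trans (norm_Re_le _) (h1 i x).
have Im1 i x : `|Im (h i x)| <= 1 := le_trans (norm_Im_le _) (h1 i x).
have bh i : cbounded_measurable (fun w => h i (X i w)).
  split; split; try by exists 1 => w.
    exact: (random_vector_comp (rX i) (mRe i)).
  exact: (random_vector_comp (rX i) (mIm i)).
pose n := size (index_enum I).
pose D (K : nat) : R := n%:R * 2 ^+ n * (2 * (2 * K%:R^-1)).
have close K : (0 < K)%N ->
    normc (cE (fun w => \prod_(i : I) h i (X i w)) -
           \prod_(i : I) cE (fun w => h i (X i w))) <= D K + D K.
  move=> K0.
  pose V : finType := ('I_(K.*2).+1 * 'I_(K.*2).+1)%type.
  pose c (v : V) : R[i] := Complex (grid_point K v.1) (grid_point K v.2).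
  pose A i (v : V) : set 'rV[R]_d :=
    [set x | grid_cell K v.1 (Re (h i x))] `&`
    [set x | grid_cell K v.2 (Im (h i x))].
  pose q i x : R[i] := \sum_(v : V) c v * (\1_(A i v) x)%:C%C.
  have mA i v : borel_rV (A i v).
    rewrite borel_rVE; apply: (@measurableI _ Borel);
      exact: measurable_grid_cell.
  have qE i x : exists2 v, q i x = c v & A i v x.
    have [v1 cv1 u1] := grid_cell_exists K (Re1 i x).
    have [v2 cv2 u2] := grid_cell_exists K (Im1 i x).
    exists (v1, v2) => //; apply: sum_pointmass; first by rewrite indicE mem_set.
    move=> v vN; rewrite indicE memNset// => -[/= /u1 e1 /u2 e2].
    by move/eqP: vN; apply; rewrite -e1 -e2; case: (v).
  have K1 : (0 : R) <= K%:R^-1 by rewrite invr_ge0.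
  have cM v : normc (c v) <= 2.
    by rewrite -[leRHS]mulr1; apply: normc_le2; exact: grid_point_le1.
  have qM i x : normc (q i x) <= 2 by have [v -> _] := qE i x.
  have hq i x : normc (h i x - q i x) <= 2 * K%:R^-1.
    have [v -> [Av1 Av2]] := qE i x.
    by apply: normc_le2; rewrite ?Re_complexB ?Im_complexB; exact: grid_cell_close.
  have hM i x : normc (h i x) <= 2 by rewrite (le_trans (h1 i x))// ler1n.
  have bq i : cbounded_measurable (fun w => q i (X i w)).
    apply: complex_combination_bounded_measurable => v.
    have -> : (fun w => \1_(A i v) (X i w)) = \1_(X i @^-1` A i v) :> (T -> R).
      by apply/funext => w; rewrite !indicE.
    by apply: bounded_measurable_indic; exact: rX.
  have [bprod qprod] := independent_simple_prod c rX indX mA.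
  have step1 : normc (cE (fun w => \prod_(i : I) h i (X i w)) -
                      cE (fun w => \prod_(i : I) q i (X i w))) <= D K.
    have -> : D K = 2 * (n%:R * 2 ^+ n * (2 * K%:R^-1)) by rewrite /D; ring.
    apply: complex_expectation_close => //; first exact: cbounded_measurable_prod.
    by move=> w; apply: normc_prodB_le => //; rewrite ler1n.
  have EM (Z : T -> R[i]) : cbounded_measurable Z ->
      (forall w, `|Re (Z w)| <= 1) -> (forall w, `|Im (Z w)| <= 1) ->
      normc (cE Z) <= 2.
    move=> [rZ iZ] rZ1 iZ1; rewrite -[leRHS]mulr1.
    by apply: normc_le2; exact: le_norm_mean.
  have step2 : normc (\prod_(i : I) cE (fun w => q i (X i w)) -
      \prod_(i : I) cE (fun w => h i (X i w))) <= D K.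
    apply: normc_prodB_le => [|i|i|i]; first by rewrite ler1n.
    - by apply: EM => // w; have [v -> _] := qE i (X i w); exact: grid_point_le1.
    - by apply: EM.
    - apply: complex_expectation_close => // w.
      by rewrite -opprB normcN hq.
  rewrite -[X in normc X](subrKA (cE (fun w => \prod_(i : I) q i (X i w)))).
  apply: le_trans (le_normcD _ _) _; apply: lerD => //.
  by rewrite qprod.
set x := _ - _ in close.
apply/eqP; rewrite -subr_eq0; apply/eqP/ComplexField.Normc.eq0_normc.
apply/eqP; rewrite eq_le normc_ge0 andbT leNgt; apply/negP => x0.
(* D K + D K = B / K drops below any positive number *)
pose B : R := n%:R * 2 ^+ n * 8.
pose K := (Num.truncn (B / normc x)).+1.
have := close K isT; apply/negP; rewrite -ltNge.
have -> : D K + D K = B / K%:R.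
  by rewrite /D /B; field; rewrite pnatr_eq0.
rewrite ltr_pdivrMr ?ltr0n// mulrC -ltr_pdivrMr//; exact: truncnS_gt.
Qed.

End independence_expectation.

(** * Characteristic functions *)

Section euclidean_theory.
Context {R : realType} {d : nat}.
Implicit Types t x : 'rV[R]_d.

Lemma dotvZl (a : R) t x : dotv (a *: t) x = a * dotv t x.
Proof. by rewrite /dotv mulr_sumr; apply: eq_bigr => j _; rewrite mxE mulrA. Qed.

Lemma dotvZr (a : R) t x : dotv t (a *: x) = a * dotv t x.
Proof. by rewrite /dotv mulr_sumr; apply: eq_bigr => j _; rewrite mxE mulrCA. Qed.

Lemma dotvBl t s x : dotv (t - s) x = dotv t x - dotv s x.
Proof. by rewrite /dotv -sumrB; apply: eq_bigr => j _; rewrite !mxE mulrBl. Qed.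

Lemma dotv_sumr (I : Type) (s : seq I) t (F : I -> 'rV[R]_d) :
  dotv t (\sum_(i <- s) F i) = \sum_(i <- s) dotv t (F i).
Proof.
rewrite /dotv exchange_big/=; apply: eq_bigr => j _.
by rewrite summxE mulr_sumr.
Qed.

Lemma norm2_ge0 t : 0 <= norm2 t. Proof. exact: sqrtr_ge0. Qed.

Lemma sqr_norm2 t : norm2 t ^+ 2 = \sum_(j < d) t 0 j ^+ 2.
Proof. by rewrite sqr_sqrtr// sumr_ge0// => j _; rewrite sqr_ge0. Qed.

Lemma norm2Z (a : R) t : norm2 (a *: t) = `|a| * norm2 t.
Proof.
rewrite /norm2 -sqrtr_sqr -sqrtrM ?sqr_ge0// mulr_sumr; congr Num.sqrt.
by apply: eq_bigr => j _; rewrite mxE exprMn.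
Qed.

Lemma norm_coord_le_norm2 t j : `|t 0 j| <= norm2 t.
Proof.
rewrite -sqrtr_sqr ler_wsqrtr// (bigD1 j)//= lerDl sumr_ge0// => i _.
exact: sqr_ge0.
Qed.

End euclidean_theory.

Section characteristic_function.
Context {disp : measure_display} {T : measurableType disp} {R : realType}
  (P : probability T R) {d : nat}.
Implicit Types (X : T -> 'rV[R]_d) (t : 'rV[R]_d).

Lemma normc_expi (x : R) : normc (expi x) = 1.
Proof. by rewrite normcE /= cos2Dsin2 sqrtr1. Qed.

Lemma expiD (x y : R) : expi (x + y) = expi x * expi y.
Proof.
apply/eqP; rewrite eq_complex Re_complexM Im_complexM /= cosD sinD eqxx/=.
by rewrite addrC.
Qed.

Lemma expi_sum (I : Type) (s : seq I) (F : I -> R) :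
  expi (\sum_(i <- s) F i) = \prod_(i <- s) expi (F i).
Proof.
elim: s => [|i s IH]; rewrite ?big_nil ?big_cons ?expiD ?IH//.
by rewrite /expi cos0 sin0.
Qed.

Lemma random_vector_dotv X t : random_vector X ->
  measurable_fun setT (fun w => dotv t (X w)).
Proof. by move=> rX; apply: random_vector_comp rX (measurable_dotv t). Qed.

Lemma bounded_measurable_cos (f : T -> R) :
  measurable_fun setT f -> bounded_measurable (fun w => cos (f w)).
Proof.
move=> mf; split; last by exists 1 => w; exact: cos_max.
by apply: measurableT_comp mf; exact: (continuous_measurable_fun (@continuous_cos R)).
Qed.

Lemma bounded_measurable_sin (f : T -> R) :
  measurable_fun setT f -> bounded_measurable (fun w => sin (f w)).
Proof.
move=> mf; split; last by exists 1 => w; exact: sin_max.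
by apply: measurableT_comp mf; exact: (continuous_measurable_fun (@continuous_sin R)).
Qed.

Lemma charfun_independent_sum (I : finType) (X : I -> T -> 'rV[R]_d) t :
  (forall i, random_vector (X i)) -> mutually_independent P X ->
  charfun P (fun w => \sum_i X i w) t = \prod_i charfun P (X i) t.
Proof.
move=> rX indX; rewrite /charfun.
under eq_fun do rewrite dotv_sumr expi_sum.
apply: (independent_expectation_prod (h := fun _ x => expi (dotv t x))) => //.
- move=> i; apply: measurableT_comp (measurable_dotv t).
  exact: (continuous_measurable_fun (@continuous_cos R)).
- move=> i; apply: measurableT_comp (measurable_dotv t).
  exact: (continuous_measurable_fun (@continuous_sin R)).
- by move=> i x; rewrite normc_expi.
Qed.

Lemma charfun_scale X (a : R) t :
  charfun P (fun w => a *: X w) t = charfun P X (a *: t).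
Proof. by rewrite /charfun; under eq_fun do rewrite dotvZr -dotvZl. Qed.

(** With u a unit complex number such that u phi (t) = |phi (t)|, the real part c of
    u exp (i t . X) has expectation |phi (t)|, and that of its square, 2 c^2 - 1,
    has expectation Re (u^2 phi (2 t)) <= |phi (2 t)|. It remains to integrate
    4 c - 3 <= 2 c^2 - 1, which is 2 (c - 1)^2 >= 0. *)
Lemma charfun_doubling X t : random_vector X ->
  1 - normc (charfun P X (2 *: t)) <= 4 * (1 - normc (charfun P X t)).
Proof.
move=> rX; have mX := random_vector_dotv t rX.
have m2X := random_vector_dotv (2 *: t) rX.
set phi := charfun P X t; set psi := charfun P X (2 *: t).
have psi0 := normc_ge0 psi.
have [->|phi0] := eqVneq (normc phi) 0; first by lra.
(* the unit u is p - i q *)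
pose p := Re phi / normc phi; pose q := Im phi / normc phi.
have pq1 : p ^+ 2 + q ^+ 2 = 1.
  by rewrite /p /q !expr_div_n -mulrDl -sqr_normcE divff// sqrf_eq0.
have bcos := bounded_measurable_cos mX; have bsin := bounded_measurable_sin mX.
have bcos2 := bounded_measurable_cos m2X.
have bsin2 := bounded_measurable_sin m2X.
have bZ (c : R) (f : T -> R) : bounded_measurable f ->
    bounded_measurable (fun w => c * f w).
  by move=> bf; apply: bounded_measurableM => //; exact: bounded_measurable_cst.
have lin a b c (f g : T -> R) : bounded_measurable f -> bounded_measurable g ->
    mean P (fun w => a * f w + b * g w + c) = a * mean P f + b * mean P g + c.
  move=> bf bg; rewrite meanD ?mean_cst//; last exact: bounded_measurable_cst.
    by rewrite meanD ?meanZ//; exact: bZ.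
  by apply: bounded_measurableD; exact: bZ.
have blin a b c (f g : T -> R) : bounded_measurable f -> bounded_measurable g ->
    bounded_measurable (fun w => a * f w + b * g w + c).
  move=> bf bg; apply: bounded_measurableD; last exact: bounded_measurable_cst.
  by apply: bounded_measurableD; exact: bZ.
have key w :
    4 * p * cos (dotv t (X w)) + 4 * q * sin (dotv t (X w)) + (-3) <=
    (p ^+ 2 - q ^+ 2) * cos (dotv (2 *: t) (X w))
    + 2 * p * q * sin (dotv (2 *: t) (X w)) + 0.
  rewrite dotvZl [2 * dotv _ _]mulr_natl cos_mulr2n sin_mulr2n.
  have := cos2Dsin2 (dotv t (X w)).
  set c := cos _; set s := sin _ => cs1.
  have e : (p ^+ 2 - q ^+ 2) * (c ^+ 2 *+ 2 - 1)
      + 2 * p * q * ((c * s) *+ 2) + 0 = 2 * (p * c + q * s) ^+ 2 - 1.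
    transitivity (2 * (p * c + q * s) ^+ 2 - 1
        - 2 * q ^+ 2 * (c ^+ 2 + s ^+ 2 - 1) - (p ^+ 2 + q ^+ 2 - 1));
      first by ring.
    by rewrite pq1 cs1 subrr mulr0 !subr0.
  rewrite e; have := sqr_ge0 (p * c + q * s - 1); lra.
have := le_mean P (blin _ _ _ _ _ bcos bsin) (blin _ _ _ _ _ bcos2 bsin2) key.
rewrite !lin//.
rewrite -[mean P _]/(Re phi) -[X in _ + 4 * q * X]/(Im phi).
rewrite -[X in _ <= _ * X + _ + _]/(Re psi) -[X in _ <= _ + _ * X + _]/(Im psi).
have -> : 4 * p * Re phi + 4 * q * Im phi = 4 * normc phi.
  transitivity (4 * (p ^+ 2 + q ^+ 2) * normc phi); last by rewrite pq1 mulr1.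
  have -> : Re phi = p * normc phi by rewrite divfK.
  have -> : Im phi = q * normc phi by rewrite divfK.
  ring.
(* Cauchy-Schwarz for the unit vector (p^2 - q^2, 2 p q) *)
have : (p ^+ 2 - q ^+ 2) * Re psi + 2 * p * q * Im psi <= normc psi.
  apply: le_trans (ler_norm _) _.
  rewrite -(@ler_pXn2r _ 2) ?nnegrE// real_normK ?num_real// sqr_normcE.
  have -> : Re psi ^+ 2 + Im psi ^+ 2 =
      (p ^+ 2 + q ^+ 2) ^+ 2 * (Re psi ^+ 2 + Im psi ^+ 2).
    by rewrite pq1 expr1n mul1r.
  have := sqr_ge0 ((p ^+ 2 - q ^+ 2) * Im psi - 2 * p * q * Re psi).
  rewrite -subr_ge0 [X in _ -> 0 <= X](_ : _ = 
    ((p ^+ 2 - q ^+ 2) * Im psi - 2 * p * q * Re psi) ^+ 2)//; ring.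
lra.
Qed.

End characteristic_function.

(** * Average modulus of the characteristic functions *)

Lemma dyadic_scale (R : realType) (x r : R) : 0 < x -> x <= r ->
  exists k, r < 2 ^+ k * x <= 2 * r.
Proof.
move=> x0 xr.
have ex : exists k, r < 2 ^+ k * x.
  exists (Num.truncn (r / x)).+1; rewrite -ltr_pdivrMr//.
  apply: lt_le_trans (truncnS_gt _) _.
  by rewrite -natrX ler_nat ltnW// ltn_expl.
have := ex_minnP ex => -[[|k] rk kmin].
  by move: rk; rewrite expr0 mul1r ltNge xr.
exists k.+1; rewrite rk/= exprS -mulrA ler_pM2l// leNgt; apply/negP => /kmin.
by rewrite ltnn.
Qed.

Section mean_modulus.
Context {disp : measure_display} {T : measurableType disp} {R : realType}
  (P : probability T R) {d n : nat} (X : 'I_n -> T -> 'rV[R]_d).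
Hypothesis n_gt0 : (0 < n)%N.
Hypothesis X_rv : forall i, random_vector (X i).
Implicit Types t : 'rV[R]_d.

Definition mean_modulus t : R :=
  n%:R^-1 * \sum_(i < n) normc (charfun P (X i) t).

Let nR_gt0 : (0 : R) < n%:R. Proof. by rewrite ltr0n. Qed.

Lemma mean_modulus_defect t :
  n%:R * (1 - mean_modulus t) = \sum_(i < n) (1 - normc (charfun P (X i) t)).
Proof.
rewrite sumrB sumr_const card_ord /mean_modulus mulrBr mulr1 mulrA divff ?mul1r//.
by rewrite gt_eqF.
Qed.

Lemma mean_modulus_doubling k t :
  1 - mean_modulus (2 ^+ k *: t) <= 4 ^+ k * (1 - mean_modulus t).
Proof.
elim: k => [|k IH]; first by rewrite !expr0 scale1r mul1r.
have step s : 1 - mean_modulus (2 *: s) <= 4 * (1 - mean_modulus s).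
  rewrite -(ler_pM2l nR_gt0) mulrCA !mean_modulus_defect mulr_sumr.
  by apply: ler_sum => i _; exact: charfun_doubling.
rewrite !exprS -scalerA -mulrA; apply: le_trans (step _) _.
by rewrite ler_pM2l.
Qed.

(** Choose k with r < 2^k |t| <= 2 r: there the Cramer bound is at least the
    constant C / (2 r)^b, and coming back to t through k doublings divides it by
    4^k <= 4 r^2 / |t|^2. *)
Lemma mean_modulus_quadratic (b C r : R) : 0 < b -> 0 < C -> 0 < r ->
  (forall t, r < norm2 t -> mean_modulus t <= 1 - C / norm2 t `^ b) ->
  forall t, norm2 t <= r ->
    C / ((2 * r) `^ b * (4 * r ^+ 2)) * norm2 t ^+ 2 <= 1 - mean_modulus t.
Proof.
move=> b0 C0 r0 cramer t tr.
have rb0 : 0 < (2 * r) `^ b by rewrite powR_gt0// mulr_gt0.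
have := norm2_ge0 t; rewrite le_eqVlt => /orP[/eqP t0|t0].
  (* at the origin, one doubling reads 1 - m(0) <= 4 (1 - m(0)) *)
  have t00 : t = 0.
    apply/rowP => j; rewrite mxE; apply/eqP.
    by rewrite -normr_eq0 eq_le normr_ge0 andbT t0 norm_coord_le_norm2.
  have := mean_modulus_doubling 1 t.
  by rewrite t00 scaler0 expr1 -t00 -t0 expr0n/= mulr0; lra.
have [k /andP[rk kr]] := dyadic_scale t0 tr.
set u := 2 ^+ k * norm2 t in rk kr.
have uE : norm2 (2 ^+ k *: t) = u by rewrite norm2Z ger0_norm// exprn_ge0.
have h1 : C / (2 * r) `^ b <= 4 ^+ k * (1 - mean_modulus t).
  apply: le_trans _ (mean_modulus_doubling k t).
  have := cramer (2 ^+ k *: t); rewrite uE => /(_ rk) h.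
  have u0 : 0 < u by exact: lt_trans rk.
  suff : C / (2 * r) `^ b <= C / u `^ b by lra.
  rewrite ler_pM2l// lef_pV2 ?posrE ?powR_gt0 ?mulr_gt0//.
  by apply: ge0_ler_powR => //; rewrite ?nnegrE; lra.
have q0 : 0 <= 1 - mean_modulus t.
  have : 0 <= 4 ^+ k * (1 - mean_modulus t).
    by apply: le_trans h1; rewrite divr_ge0// ltW.
  by rewrite pmulr_rge0// exprn_gt0.
have h2 : 4 ^+ k * norm2 t ^+ 2 <= 4 * r ^+ 2.
  have -> : 4 ^+ k * norm2 t ^+ 2 = u ^+ 2.
    by rewrite /u exprMn -exprM mulnC exprM (_ : 2 ^+ 2 = 4)//; ring.
  have -> : 4 * r ^+ 2 = (2 * r) ^+ 2 by ring.
  by rewrite lerXn2r ?nnegrE//; lra.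
have h3 := ler_wpM2r (sqr_ge0 (norm2 t)) h1.
have h4 := ler_wpM2r q0 h2.
rewrite (_ : C / _ * _ = C / (2 * r) `^ b * norm2 t ^+ 2 / (4 * r ^+ 2)); last first.
  by field; rewrite !gt_eqF.
rewrite ler_pdivrMr; last by rewrite mulr_gt0// exprn_gt0.
apply: le_trans h3 _; apply: le_trans _ (le_trans h4 _); lra.
Qed.

(** Each factor satisfies x <= exp (x - 1). *)
Lemma prod_charfun_le_expR t :
  \prod_(i < n) normc (charfun P (X i) t)
    <= expR (- (n%:R * (1 - mean_modulus t))).
Proof.
rewrite mean_modulus_defect -sumrN expR_sum; apply: ler_prod => i _.
rewrite normc_ge0 andTb; set x := normc _.
by have := expR_ge1Dx (- (1 - x)); lra.
Qed.

End mean_modulus.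

(** * Concentration and sums over integer points *)

Section concentration.
Context {disp : measure_display} {T : measurableType disp} {R : realType}
  (P : probability T R) {d : nat}.

Definition lattice_point (N : nat) (k : {ffun 'I_d -> 'I_N}) : 'rV[R]_d :=
  \row_j (k j)%:R.

(** The double sum is the squared modulus of the sum of the exp (i a(k)). *)
Lemma sum_cos_sub_ge (I : finType) (a : I -> R) :
  (\sum_(k : I) cos (a k)) ^+ 2 <= \sum_(k : I) \sum_(l : I) cos (a k - a l).
Proof.
have -> : \sum_k \sum_l cos (a k - a l) =
    (\sum_k cos (a k)) ^+ 2 + (\sum_k sin (a k)) ^+ 2.
  rewrite !expr2 !mulr_suml -big_split; apply: eq_bigr => k _ /=.
  by rewrite !mulr_sumr -big_split; apply: eq_bigr => l _; exact: cosB.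
by rewrite lerDl sqr_ge0.
Qed.

(** A discrete form of Esseen's concentration inequality. The event A forces every
    phase k . Y to lie in [-1, 1], where the cosine is at least cos 1 > 0. *)
Lemma concentration_le_lattice_sum (Y : T -> 'rV[R]_d) (N : nat) (A : set T) :
  (0 < d)%N -> (0 < N)%N ->
  (forall t, measurable_fun setT (fun w => dotv t (Y w))) -> measurable A ->
  (forall w, A w -> forall j, `|Y w 0 j| <= (d%:R * N%:R)^-1) ->
  (N%:R ^+ d * cos 1) ^+ 2 * fine (P A) <=
  \sum_(k : {ffun 'I_d -> 'I_N}) \sum_(l : {ffun 'I_d -> 'I_N})
    normc (charfun P Y (lattice_point k - lattice_point l)).
Proof.
move=> d0 N0 mY mA AY.
have dR : (0 : R) < d%:R by rewrite ltr0n.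
have NR : (0 : R) < N%:R by rewrite ltr0n.
pose K : finType := {ffun 'I_d -> 'I_N}.
have cosY (t : 'rV[R]_d) : bounded_measurable (fun w => cos (dotv t (Y w))).
  by apply: bounded_measurable_cos; exact: mY.
have bA := bounded_measurable_indic mA (R := R).
have pointwise w : (N%:R ^+ d * cos 1) ^+ 2 * \1_A w <=
    \sum_(k : K) \sum_(l : K)
      cos (dotv (lattice_point k - lattice_point l) (Y w)).
  apply: (@le_trans _ _
    ((\sum_(k : K) cos (dotv (lattice_point k) (Y w))) ^+ 2)); last first.
    apply: le_trans (sum_cos_sub_ge _) _.
    by apply: ler_sum => k _; apply: ler_sum => l _; rewrite dotvBl.
  rewrite indicE; have [/set_mem Aw|_] := boolP (w \in A); last by rewrite mulr0 sqr_ge0.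
  rewrite mulr1.
  have cos1 (k : K) : cos 1 <= cos (dotv (lattice_point k) (Y w)).
    have : `|dotv (lattice_point k) (Y w)| <= 1.
      apply: le_trans (ler_norm_sum _ _ _) _.
      apply: (@le_trans _ _ (\sum_(j < d) (d%:R^-1 : R))).
        apply: ler_sum => j _; rewrite normrM mxE normr_nat.
        rewrite (_ : d%:R^-1 = N%:R * (d%:R * N%:R)^-1); last first.
          by field; rewrite !gt_eqF.
        by apply: ler_pM => //; [rewrite ler_nat ltnW | exact: AY].
      by rewrite sumr_const card_ord -[leLHS]mulr_natl divff// gt_eqF.
    rewrite -[cos (dotv _ _)]cos_norm.
    have pi2 : 2 <= pi :> R := pi_ge2 _.
    set x := `|_|; move=> x1; have x0 : 0 <= x := normr_ge0 _.
    rewrite leNgt ltr_cos ?in_itv/= -?leNgt//; apply/andP; split; lra.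
  have NdE : N%:R ^+ d * cos 1 = \sum_(k : K) cos 1 :> R.
    by rewrite sumr_const card_ffun !card_ord -[RHS]mulr_natl natrX.
  apply: lerXn2r; rewrite ?nnegrE ?NdE.
  - by apply: sumr_ge0 => k _; rewrite ltW// cos1_gt0.
  - by apply: sumr_ge0 => k _; apply: le_trans (cos1 k); rewrite ltW// cos1_gt0.
  - by apply: ler_sum => k _.
rewrite -(mean_indic P mA) -meanZ//.
apply: le_trans (le_mean P _ _ pointwise) _.
- by apply: bounded_measurableM => //; exact: bounded_measurable_cst.
- apply: bounded_measurable_sum => k; apply: bounded_measurable_sum => l.
  exact: cosY.
rewrite mean_sum; last first.
  by move=> k; apply: bounded_measurable_sum => l; exact: cosY.
apply: ler_sum => k _; rewrite mean_sum; last by move=> l; exact: cosY.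
apply: ler_sum => l _.
exact: (le_trans (ler_norm _) (norm_Re_le (charfun P Y _))).
Qed.

Lemma sum_geometric_le (q : R) (n : nat) : 0 <= q -> q < 1 ->
  \sum_(i < n) q ^+ i <= (1 - q)^-1.
Proof.
move=> q0 q1; rewrite -[leRHS]mul1r ler_pdivlMr ?subr_gt0//.
have := subrX1 q n; have : 0 <= q ^+ n by exact: exprn_ge0.
move=> qn e; have -> : (\sum_(i < n) q ^+ i) * (1 - q) = 1 - q ^+ n.
  by rewrite -opprB mulrN mulrC -e opprB.
by rewrite lerBlDr lerDl.
Qed.

Lemma sum_geometric_two_sided_le (q : R) (N l : nat) :
  0 <= q -> q < 1 -> (l <= N)%N ->
  \sum_(m < N) q ^+ `|(m%:Z - l%:Z)%R|%N <= 2 * (1 - q)^-1.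
Proof.
move=> q0 q1 lN.
rewrite -(big_mkord xpredT (fun m => q ^+ `|(m%:Z - l%:Z)%R|%N)).
rewrite (big_cat_nat (leq0n l) lN)/= mulr_natl mulr2n; apply: lerD.
  rewrite big_nat_rev/= add0n.
  apply: le_trans (sum_geometric_le l q0 q1); rewrite big_mkord.
  apply: ler_sum => i _; rewrite (_ : `|_|%N = i.+1); last first.
    by have := ltn_ord i; lia.
  by rewrite exprS ler_piMl ?exprn_ge0// ltW.
rewrite -{1}[l]add0n big_addn big_mkord.
apply: le_trans (sum_geometric_le (N - l) q0 q1).
by apply: ler_sum => i _; rewrite (_ : `|_|%N = i)//; lia.
Qed.

(** The sum factors over the coordinates, and x^2 >= |x| at integers compares each
    factor with a two-sided geometric series of ratio exp (- c). *)
Lemma gaussian_lattice_sum_le (c : R) (N : nat) (l : {ffun 'I_d -> 'I_N}) :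
  0 < c ->
  \sum_(k : {ffun 'I_d -> 'I_N})
     expR (- (c * norm2 (lattice_point k - lattice_point l) ^+ 2))
  <= (2 * (1 - expR (- c))^-1) ^+ d.
Proof.
move=> c0.
have q0 : 0 <= expR (- c) by exact: expR_ge0.
have q1 : expR (- c) < 1 by rewrite expR_lt1 oppr_lt0.
have -> : \sum_(k : {ffun 'I_d -> 'I_N})
     expR (- (c * norm2 (lattice_point k - lattice_point l) ^+ 2)) =
   \prod_(j < d) \sum_(m < N) expR (- (c * ((m%:R : R) - (l j)%:R) ^+ 2)).
  rewrite bigA_distr_bigA; apply: eq_bigr => k _.
  rewrite sqr_norm2 mulr_sumr -sumrN expR_sum; apply: eq_bigr => j _.
  by rewrite !mxE.
rewrite -[d in leRHS]card_ord -prodr_const; apply: ler_prod => j _.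
rewrite sumr_ge0 ?andTb; last by move=> m _; exact: expR_ge0.
apply: le_trans (sum_geometric_two_sided_le q0 q1 (ltnW (ltn_ord (l j)))).
apply: ler_sum => m _; rewrite -expRM_natl ler_expR mulrN lerN2 mulrC ler_pM2l//.
have -> : (m%:R : R) - (l j)%:R = ((m%:Z - (l j)%:Z)%R)%:~R.
  by rewrite rmorphB.
rewrite -rmorphXn -[leLHS]/((`|_|%N%:Z)%:~R) ler_int expr2.
by set z := (_ - _)%R; nia.
Qed.

End concentration.

Lemma norm2_lattice_sub_le (R : realType) (d N : nat)
    (k l : {ffun 'I_d -> 'I_N}) :
  norm2 (lattice_point k - lattice_point l : 'rV[R]_d) <= d%:R * N%:R.
Proof.
rewrite -(@ler_pXn2r _ 2) ?nnegrE ?norm2_ge0 ?mulr_ge0//.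
rewrite sqr_norm2; apply: (@le_trans _ _ (\sum_(j < d) (N%:R ^+ 2 : R))).
  apply: ler_sum => j _; rewrite !mxE -real_normK ?num_real//.
  apply: lerXn2r; rewrite ?nnegrE//.
  have := ltn_ord (k j); have := ltn_ord (l j); rewrite -!(ltr_nat R).
  have : (0 : R) <= (k j)%:R by []; have : (0 : R) <= (l j)%:R by [].
  by rewrite ler_norml => *; apply/andP; split; lra.
rewrite sumr_const card_ord -[leLHS]mulr_natl exprMn ler_wpM2r// ?exprn_ge0//.
by rewrite -natrX ler_nat; case: (d) => // e; rewrite expnS leq_pmulr// expn1.
Qed.

(** * The normalized sum *)

Section normalized_sum.
Context {disp : measure_display} {T : measurableType disp} {R : realType}
  (P : probability T R) {d n : nat} (X : 'I_n -> T -> 'rV[R]_d).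
Hypothesis n_gt0 : (0 < n)%N.
Hypothesis X_rv : forall i, random_vector (X i).
Hypothesis X_indep : mutually_independent P X.

Definition normalized_sum (w : T) : 'rV[R]_d :=
  (Num.sqrt n%:R)^-1 *: \sum_(i < n) X i w.

Lemma measurable_dotv_normalized_sum t :
  measurable_fun setT (fun w => dotv t (normalized_sum w)).
Proof.
under eq_fun do rewrite dotvZr dotv_sumr.
apply: measurable_funM; first exact: measurable_cst.
by apply: measurable_sum => i; exact: random_vector_dotv.
Qed.

Lemma measurable_norm2_sum :
  measurable_fun setT (fun w => norm2 (\sum_(i < n) X i w)).
Proof.
apply: (measurableT_comp (continuous_measurable_fun (@sqrt_continuous R))).
apply: measurable_sum => j; apply: measurable_funX.
under eq_fun do rewrite summxE.
apply: measurable_sum => i.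
exact: (random_vector_comp (X_rv i) (measurable_coord j)).
Qed.

(** The two terms correspond to frequencies t / sqrt n inside and outside the ball
    of radius r; keeping their sum avoids a case distinction when summing over
    lattice points. *)
Lemma charfun_normalized_sum_le (b C r L : R) (t : 'rV[R]_d) :
  0 < b -> 0 < C -> 0 < r -> 0 < L ->
  (forall s, r < norm2 s -> mean_modulus P X s <= 1 - C / norm2 s `^ b) ->
  norm2 t <= Num.sqrt n%:R * L ->
  normc (charfun P normalized_sum t) <=
    expR (- (C / ((2 * r) `^ b * (4 * r ^+ 2)) * norm2 t ^+ 2)) +
    expR (- (n%:R * C / L `^ b)).
Proof.
move=> b0 C0 r0 L0 cramer tL.
have n0 : (0 : R) < n%:R by rewrite ltr0n.
have sn0 : 0 < Num.sqrt (n%:R : R) by rewrite sqrtr_gt0.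
rewrite charfun_scale charfun_independent_sum// normc_prod.
set s := _ *: t.
have sE : norm2 s = norm2 t / Num.sqrt n%:R.
  by rewrite norm2Z gtr0_norm ?invr_gt0// mulrC.
apply: le_trans (prod_charfun_le_expR P X n_gt0 s) _.
have [sr|sr] := leP (norm2 s) r.
  apply: ler_wpDr; first exact: expR_ge0.
  rewrite ler_expR lerN2.
  have := mean_modulus_quadratic n_gt0 X_rv b0 C0 r0 cramer sr.
  move=> h; rewrite -(ler_pM2l n0) in h; apply: le_trans h.
  rewrite sE expr_div_n (sqr_sqrtr (ltW n0)); set c1 := C / _.
  have -> // : n%:R * (c1 * (norm2 t ^+ 2 / n%:R)) = c1 * norm2 t ^+ 2.
  by field; rewrite gt_eqF.
apply: ler_wpDl; first exact: expR_ge0.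
rewrite ler_expR lerN2 -mulrA ler_pM2l//.
have := cramer s sr; suff : C / L `^ b <= C / norm2 s `^ b by lra.
have s0 : 0 < norm2 s by exact: lt_trans sr.
rewrite ler_pM2l// lef_pV2 ?posrE ?powR_gt0//.
apply: ge0_ler_powR; rewrite ?nnegrE ?(ltW b0) ?(ltW s0) ?(ltW L0)//.
by rewrite sE ler_pdivrMr// mulrC.
Qed.

End normalized_sum.

Section asymptotics.
Context {R : realType}.

Lemma powR_natr_ge_near (M e : R) : 0 < e -> \forall n \near \oo, M <= n%:R `^ e.
Proof.
move=> e0; near=> n.
have Mn : `|M| `^ e^-1 <= n%:R by near: n; exact: nbhs_infty_ger.
apply: le_trans (ler_norm M) _.
have -> : `|M| = (`|M| `^ e^-1) `^ e by rewrite -powRrM mulVf ?powRr1// gt_eqF.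
by apply: ge0_ler_powR; rewrite ?nnegrE ?powR_ge0 ?(ltW e0).
Unshelve. all: by end_near. Qed.

(** In terms of x = n^(a/2), the left-hand side is x^(2p/a) exp (- C x^2), and
    x <= exp x turns the power into an exponential that is linear in x. *)
Lemma powR_expR_decay_near (p C a : R) : 0 <= p -> 0 < C -> 0 < a ->
  \forall n \near \oo, n%:R `^ p * expR (- (C * n%:R `^ a)) <= 1.
Proof.
move=> p0 C0 a0; have a20 : 0 < a / 2 by rewrite divr_gt0.
near=> n.
have : p / (a / 2) / C <= n%:R `^ (a / 2) by near: n; exact: powR_natr_ge_near.
set x : R := n%:R `^ (a / 2) => xM.
have x0 : 0 <= x := powR_ge0 _ _.
have -> : n%:R `^ a = x ^+ 2.
  by rewrite -powR_mulrn// -powRrM divfK.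
have -> : n%:R `^ p = x `^ (p / (a / 2)) :> R.
  by rewrite /x -powRrM mulrC divfK// gt_eqF.
have q0 : 0 <= p / (a / 2) by rewrite divr_ge0// ltW.
have xe : x `^ (p / (a / 2)) <= expR (x * (p / (a / 2))).
  rewrite expRM; apply: ge0_ler_powR; rewrite ?nnegrE ?expR_ge0//.
  by apply: le_trans (expR_ge1Dx x); rewrite lerDr.
apply: le_trans (ler_wpM2r (expR_ge0 _) xe) _.
rewrite -expRD expR_le1.
move: xM; rewrite ler_pdivrMr// => xM.
have := ler_wpM2l x0 xM; nra.
Unshelve. all: by end_near. Qed.

End asymptotics.

(** * The small ball estimate *)

Theorem theorem3p1 (R : realType) (disp : measure_display)
    (T : measurableType disp) (P : probability T R) (d : nat) (b : R)
    (X : forall n : nat, 'I_n -> T -> 'rV[R]_d)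
    (d_ge1 : (1 <= d)%N) (b_gt0 : 0 < b)
    (X_rv : forall (n : nat) (i : 'I_n), random_vector (X n i))
    (X_indep : forall n : nat, mutually_independent P (X n))
    (X_centered : forall (n : nat) (i : 'I_n), centered P (X n i))
    (X_rho3 : exists2 C : R, 0 < C &
       (ereal_sup [set rho3 P X n | n in [set n | (1 <= n)%N]] <= C%:E)%E)
    (X_cov : exists2 c : R, 0 < c &
       \forall n \near \oo,
         loewner_le c%:M (n%:R^-1 *: \sum_(i < n) cov_mx P (X n i)))
    (X_cramer : mean_weak_cramer P X b) :
  exists2 Gamma : R, 0 < Gamma &
    forall gamma : R, 0 < gamma -> gamma < 1 / b + 1 / 2 ->
      \forall n \near \oo,
        (P [set w | (1 / Num.sqrt n%:R * norm2 (\sum_(i < n) X n i w)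
                     <= 1 / n%:R `^ gamma)%R]
         <= (Gamma / n%:R `^ (d%:R * gamma))%:E)%E.
Proof.
have [C [r [C0 r0 cramer]]] := X_cramer.
pose c1 := C / ((2 * r) `^ b * (4 * r ^+ 2)).
have c10 : 0 < c1.
  by rewrite divr_gt0// mulr_gt0 ?powR_gt0 ?mulr_gt0// exprn_gt0.
pose G : R := (2 * (1 - expR (- c1))^-1) ^+ d.
have G0 : 0 <= G.
  by rewrite exprn_ge0// mulr_ge0// invr_ge0 subr_ge0 expR_le1 oppr_le0 ltW.
have d0 : (0 : R) < d%:R by rewrite ltr0n.
have kappa0 := cos1_gt0 R.
(* 2 d comes from n^gamma <= 2 d N, and G + 1 bounds the sums over a row *)
exists ((2 * d%:R) ^+ d * (G + 1) / cos 1 ^+ 2).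
  by rewrite divr_gt0 ?exprn_gt0// mulr_gt0 ?exprn_gt0 ?mulr_gt0//; lra.
move=> gamma gamma0 gammaLt.
pose a : R := 1 + b / 2 - b * gamma.
have a0 : 0 < a.
  have := gammaLt; rewrite -(ltr_pM2l b_gt0) mulrDr mulrA mulr1 divff ?gt_eqF//.
  by rewrite /a; lra.
near=> n.
have n0 : (0 < n)%N by near: n; exact: nbhs_infty_gt.
have nR : (0 : R) < n%:R by rewrite ltr0n.
have sn0 : 0 < Num.sqrt (n%:R : R) by rewrite sqrtr_gt0.
have xd : d%:R <= n%:R `^ gamma by near: n; exact: powR_natr_ge_near.
have Cr : forall t : 'rV[R]_d, r < norm2 t ->
    mean_modulus P (X n) t <= 1 - C / norm2 t `^ b.
  by near: n; exact: cramer.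
have decay : n%:R `^ (gamma * d%:R) * expR (- (C * n%:R `^ a)) <= 1.
  near: n; apply: powR_expR_decay_near => //.
  by rewrite mulr_ge0// ltW.
set x : R := n%:R `^ gamma in xd *.
have x0 : 0 < x by exact: powR_gt0.
(* dividing by d keeps |k . Y| <= 1 on the whole box *)
pose N := Num.truncn (x / d%:R).
have xd0 : 0 <= x / d%:R by rewrite divr_ge0// ltW.
have N0 : (0 < N)%N by rewrite truncn_gt0 ler_pdivlMr// mul1r.
have NR : (0 : R) < N%:R by rewrite ltr0n.
have dNx : d%:R * N%:R <= x by rewrite mulrC -ler_pdivlMr// truncn_le.
have xN : x <= 2 * d%:R * N%:R.
  have : x / d%:R < N%:R + 1 by rewrite natr1; exact: truncnS_gt.
  rewrite ltr_pdivrMr// => h; have : (1 : R) <= N%:R by rewrite ler1n.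
  by nra.
(* the frequencies (k - l) / sqrt n have norm at most L *)
pose L := x / Num.sqrt n%:R.
have L0 : 0 < L by rewrite divr_gt0.
have LE : n%:R * C / L `^ b = C * n%:R `^ a.
  have LE : L = n%:R `^ (gamma - 2^-1).
    by rewrite powRB ?(gt_eqF nR) ?implybT// powR12_sqrt.
  have nE : n%:R = n%:R `^ a * L `^ b.
    rewrite LE -powRrM -powRD ?(gt_eqF nR) ?implybT//.
    rewrite (_ : a + _ = 1) ?powRr1//.
    by rewrite /a; field.
  rewrite {1}nE; field.
  by rewrite gt_eqF// powR_gt0.
set A := [set w | _].
have mA : measurable A.
  have mf : measurable_fun setT
      (fun w => 1 / Num.sqrt n%:R * norm2 (\sum_(i < n) X n i w)).
    apply: measurable_funM; first exact: measurable_cst.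
    exact: measurable_norm2_sum.
  have mx : measurable_fun setT (fun _ : T => 1 / x) by exact: measurable_cst.
  by have := measurable_fun_le measurableT mf mx; rewrite setTI.
have AY w : A w -> forall j, `|normalized_sum (X n) w 0 j| <= (d%:R * N%:R)^-1.
  rewrite /A/= !div1r => Aw j; apply: le_trans (norm_coord_le_norm2 _ _) _.
  rewrite norm2Z gtr0_norm ?invr_gt0//; apply: le_trans Aw _.
  by rewrite lef_pV2 ?posrE ?mulr_gt0.
have := concentration_le_lattice_sum P d_ge1 N0
  (measurable_dotv_normalized_sum (X_rv n)) mA AY.
have rows (l : {ffun 'I_d -> 'I_N}) :
   \sum_(k : {ffun 'I_d -> 'I_N})
     normc (charfun P (normalized_sum (X n)) (lattice_point k - lattice_point l))
   <= G + 1.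
  apply: (@le_trans _ _ (\sum_(k : {ffun 'I_d -> 'I_N})
     (expR (- (c1 * norm2 (lattice_point k - lattice_point l) ^+ 2)) +
      expR (- (C * n%:R `^ a))))).
    apply: ler_sum => k _; rewrite -LE.
    apply: charfun_normalized_sum_le => //.
    rewrite /L [leRHS]mulrC divfK ?(gt_eqF sn0)//.
    exact: (le_trans (norm2_lattice_sub_le R k l) dNx).
  rewrite big_split/=; apply: lerD; first exact: gaussian_lattice_sum_le.
  apply: le_trans decay.
  rewrite sumr_const card_ffun !card_ord -[leLHS]mulr_natl.
  rewrite ler_wpM2r ?expR_ge0// natrX powRrM powR_mulrn ?(ltW x0)//.
  apply: lerXn2r; rewrite ?nnegrE ?(ltW x0)//.
  by apply: le_trans dNx; rewrite ler_peMl// ler1n.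
rewrite exchange_big/=.
move=> /le_trans /(_ (ler_sum _ (fun l _ => rows l))).
rewrite sumr_const card_ffun !card_ord -[leRHS]mulr_natl natrX.
set p := fine (P A) => main.
have PA : P A = p%:E by rewrite fineK// fin_num_measure.
have Nd0 : (0 : R) < N%:R ^+ d by exact: exprn_gt0.
rewrite PA lee_fin ler_pdivlMr ?powR_gt0//.
have -> : n%:R `^ (d%:R * gamma) = x ^+ d.
  by rewrite mulrC powRrM powR_mulrn// ltW.
have xNd : x ^+ d <= (2 * d%:R) ^+ d * N%:R ^+ d.
  by rewrite -exprMn; apply: lerXn2r; rewrite ?nnegrE ?(ltW x0).
have p0 : 0 <= p by rewrite fine_ge0.
apply: le_trans (ler_wpM2l p0 xNd) _.
have row_total : N%:R ^+ d * p * cos 1 ^+ 2 <= G + 1.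
  rewrite -(ler_pM2l Nd0); apply: le_trans main.
  by rewrite le_eqVlt; apply/orP; left; apply/eqP; ring.
rewrite ler_pdivlMr ?exprn_gt0//.
have -> : p * ((2 * d%:R) ^+ d * N%:R ^+ d) * cos 1 ^+ 2 =
    (2 * d%:R) ^+ d * (N%:R ^+ d * p * cos 1 ^+ 2) by ring.
by rewrite ler_pM2l// exprn_gt0// mulr_gt0.
Unshelve. all: by end_near. Qed.
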